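(* Let $n\ge 2$, let $(x_{i_1},\ldots,x_{i_k})$ be a finite sequence of Artin generators of the braid group $\mathcal{B}_n$, and let $a_1,\ldots,a_k\in\mathbb{Z}$. For $a\in\mathbb{Z}$ put $C^{a}(s)=(-1)^a s^{a-1}+s^{1-a}$. Write $\nabla_n(\beta)(s)$ for the Alexander-Conway polynomial of the closure of an $n$-braid $\beta$. Then $$\nabla_n(x_{i_1}^{a_1}\cdots x_{i_k}^{a_k})(s)=\Big(\frac{s}{s^2+1}\Big)^{k}\sum_{0\le j_1,\ldots,j_k\le 1}C^{a_1+j_1}(s)\cdots C^{a_k+j_k}(s)\,\nabla_n(x_{i_1}^{j_1}\cdots x_{i_k}^{j_k})(s).$$
   Context: The Alexander-Conway polynomial (in the variable $s$, where $t=s^{-2}$ for the usual variable $t$) is the oriented link invariant $\nabla$ with values in $\mathbb{C}[s,s^{-1}]$ determined by $\nabla(\bigcirc)=1$ (unknot) and the skein relation $\nabla(L_-)-(s^{-1}-s)\nabla(L_0)-\nabla(L_+)=0$ whenever $L_+,L_-,L_0$ are oriented diagrams identical except near one crossing, where $L_+$ has a positive crossing (both strands pointing up, the over-strand goes from lower left to upper right), $L_-$ a negative crossing and $L_0$ the oriented smoothing. Braid convention: $\mathcal{B}_n$ has Artin generators $x_1,\ldots,x_{n-1}$; in $x_i$ the strand going from top position $i$ to bottom position $i+1$ passes over the strand going from top position $i+1$ to bottom position $i$. Braids are oriented from top to bottom, so each crossing $x_i$ in the closure of a braid is a negative crossing (type $L_-$). *)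

(* Defs.v *)
From HB Require Import structures.
From mathcomp Require Import all_boot all_order all_algebra.
From mathcomp Require Import complex boolp reals.

Set Implicit Arguments.
Unset Strict Implicit.
Unset Printing Implicit Defensive.

Import GRing.Theory.

Local Open Scope quotient_scope.

(** * Oriented link diagrams

    A link diagram in general position with respect to the height function is
    a word of elementary pieces, read from top to bottom.  A strand direction
    is a boolean: [true] when the strand points down, [false] when it points
    up.  A horizontal level not meeting any piece is a sequence of directions,
    read from left to right. *)

(* [LMax a] is a local maximum whose left leg has direction [a];
   [LMin a] is a local minimum whose left leg has direction [a];
   [Crossing o a b] is a crossing of a strand of direction [a] joining the
   upper left end to the lower right end with a strand of direction [b]
   joining the upper right end to the lower left end; the former passes over
   the latter iff [o] is [true]. *)
Inductive piece :=
| LMax of bool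
| LMin of bool
| Crossing of bool & bool & bool.

Definition top_ends (p : piece) : seq bool :=
  match p with
  | LMax _ => [::]
  | LMin a => [:: a; ~~ a]
  | Crossing _ a b => [:: a; b]
  end.

Definition bottom_ends (p : piece) : seq bool :=
  match p with
  | LMax a => [:: a; ~~ a]
  | LMin _ => [::]
  | Crossing _ a b => [:: b; a]
  end.

(* [(l, p)] is the piece [p] with [l] vertical strands on its left. *)
Definition slice := (nat * piece)%type.

Definition run_slice (w : seq bool) (c : slice) : option (seq bool) :=
  let: (l, p) := c in
  let m := size (top_ends p) in
  if (l <= size w) && (take m (drop l w) == top_ends p)
  then Some (take l w ++ bottom_ends p ++ drop (l + m) w) else None.

(* The level below a sequence of slices, if the ends of successive slices
   match (in number and in direction). *)
Fixpoint run (w : seq bool) (d : seq slice) : option (seq bool) :=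
  if d is c :: d' then obind (run^~ d') (run_slice w c) else Some w.

Record link_diagram := LinkDiagram {
  slices :> seq slice;
  slicesP : run [::] slices = Some [::] }.

(** * Isotopy of links

    Isotopy of links in 3-space is generated by the following local moves
    between diagrams in general position: exchange of the heights of distant
    pieces, cancellation of a local maximum with an adjacent local minimum,
    sliding a strand past an extremum, and the three Reidemeister moves.  All
    orientations of the strands are allowed. *)
Inductive local_move : seq slice -> seq slice -> Prop :=
| move_exchange l m p q :
    local_move [:: (l, p); (l + size (bottom_ends p) + m, q)]
               [:: (l + size (top_ends p) + m, q); (l, p)]
| move_zigzag_right l a :
    local_move [:: (l, LMax a); (l.+1, LMin (~~ a))] [::]
| move_zigzag_left l a :
    local_move [:: (l.+1, LMax (~~ a)); (l, LMin a)] [::]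
| move_slide_max l o a c :
    local_move [:: (l, LMax a); (l.+1, Crossing o (~~ a) c)]
               [:: (l.+1, LMax a); (l, Crossing (~~ o) c a)]
| move_slide_min l o a c :
    local_move [:: (l.+1, Crossing o c (~~ a)); (l, LMin a)]
               [:: (l, Crossing (~~ o) a c); (l.+1, LMin a)]
| move_R1_max l o a :
    local_move [:: (l, LMax a); (l, Crossing o a (~~ a))]
               [:: (l, LMax (~~ a))]
| move_R1_min l o a :
    local_move [:: (l, Crossing o a (~~ a)); (l, LMin (~~ a))]
               [:: (l, LMin a)]
| move_R2 l o a b :
    local_move [:: (l, Crossing o a b); (l, Crossing (~~ o) b a)] [::]
(* The side condition says that "passing over" is transitive on the three
   strands, i.e., that one of them is on top and one of them is at the
   bottom. *)
| move_R3 l o1 o2 o3 a b c of (o1 == o3) ==> (o2 == o1) :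
    local_move
      [:: (l, Crossing o1 a b); (l.+1, Crossing o2 a c); (l, Crossing o3 b c)]
      [:: (l.+1, Crossing o3 b c); (l, Crossing o2 a c);
          (l.+1, Crossing o1 a b)].

Definition diagram_move (L L' : link_diagram) : Prop :=
  exists d1 d2 m m', [/\ local_move m m',
    slices L = d1 ++ m ++ d2 & slices L' = d1 ++ m' ++ d2].

Definition link_invariant (T : Type) (f : link_diagram -> T) : Prop :=
  forall L L', diagram_move L L' -> f L = f L'.

(** * Skein triples *)

(* When the two strands of a crossing are parallel, rotate it so that both
   point up: it is then positive iff the strand joining the lower left end to
   the upper right end is over.  When they are antiparallel, the rotation is a
   quarter turn, which exchanges the two diagonals. *)
Definition pos_crossing (a b : bool) := Crossing (a != b) a b.
Definition neg_crossing (a b : bool) := Crossing (a == b) a b.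

Definition smoothing (l : nat) (a b : bool) : seq slice :=
  if a == b then [::] else [:: (l, LMin a); (l, LMax b)].

Definition skein_triple (Lp Lm L0 : link_diagram) : Prop :=
  exists d1 d2 l a b, [/\
    slices Lp = d1 ++ (l, pos_crossing a b) :: d2,
    slices Lm = d1 ++ (l, neg_crossing a b) :: d2 &
    slices L0 = d1 ++ smoothing l a b ++ d2].

Lemma unknotP : run [::] [:: (0, LMax true); (0, LMin true)] = Some [::].
Proof. by []. Qed.

Definition unknot := LinkDiagram unknotP.

(** * The Alexander-Conway polynomial

    Laurent polynomials over the complex numbers [R[i]] are viewed inside the
    field [C(s)] of rational functions. *)

Notation Cs R := {fraction {poly R[i]}}.

Definition svar (R : realType) : Cs R := tofrac ('X : {poly R[i]})%R.

Definition is_laurent (R : realType) (f : Cs R) : Prop :=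
  exists (p : {poly R[i]}) (m : nat), (f = tofrac p * svar R ^- m)%R.

Record alexander_conway (R : realType) (nabla : link_diagram -> Cs R) : Prop :=
  AlexanderConway {
    conway_laurent : forall L, is_laurent (nabla L);
    conway_invariant : link_invariant nabla;
    conway_unknot : (nabla unknot = 1)%R;
    conway_skein : forall Lp Lm L0, skein_triple Lp Lm L0 ->
      (nabla Lm - ((svar R)^-1 - svar R) * nabla L0 - nabla Lp = 0)%R }.

(** * Braid groups *)

(* The letter [(i, true)] stands for the Artin generator of index [i] (counted
   from 0), and [(i, false)] for its inverse. *)
Definition braid_word (n : nat) := seq ('I_n.-1 * bool).

Section BraidGroup.
Variable n : nat.
Implicit Types u v w : braid_word n.

Inductive braid_eq : braid_word n -> braid_word n -> Prop :=
| braid_refl w : braid_eq w w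
| braid_sym v w : braid_eq v w -> braid_eq w v
| braid_trans u v w : braid_eq u v -> braid_eq v w -> braid_eq u w
| braid_cat v v' w w' :
    braid_eq v v' -> braid_eq w w' -> braid_eq (v ++ w) (v' ++ w')
| braid_cancel i e : braid_eq [:: (i, e); (i, ~~ e)] [::]
| braid_far (i j : 'I_n.-1) of i.+1 < j :
    braid_eq [:: (i, true); (j, true)] [:: (j, true); (i, true)]
| braid_near (i j : 'I_n.-1) of j = i.+1 :> nat :
    braid_eq [:: (i, true); (j, true); (i, true)]
             [:: (j, true); (i, true); (j, true)].

Definition braid_eqb u v : bool := `[< braid_eq u v >].

Lemma braid_eqb_equiv : equiv_class_of braid_eqb.
Proof.
split=> [w|v w|v u w].
- exact/asboolP/braid_refl.
- by apply/asboolP/asboolP; apply: braid_sym.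
- by move=> /asboolP vu /asboolP uw; apply/asboolP/(braid_trans vu).
Qed.

Canonical braid_equiv := EquivRelPack braid_eqb_equiv.

Definition braid : Type := {eq_quot braid_equiv}%qT.
HB.instance Definition _ := Choice.on braid.
HB.instance Definition _ := EqQuotient.on braid.

Definition winv w : braid_word n := rev [seq (c.1, ~~ c.2) | c <- w].

Lemma braid_piP v w : reflect (braid_eq v w) (\pi_braid v == \pi_braid w).
Proof. by rewrite eqmodE; exact: asboolP. Qed.

Lemma braid_reprK w : braid_eq (repr (\pi_braid w)) w.
Proof. by apply/braid_piP; rewrite reprK. Qed.

Lemma winvK : involutive winv.
Proof.
move=> w; rewrite /winv map_rev revK -map_comp -[RHS]map_id.
by apply: eq_map => -[i e] /=; rewrite negbK.
Qed.

Lemma winvr w : braid_eq (w ++ winv w) [::].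
Proof.
elim: w => [|[i e] w IHw]; first exact: braid_refl.
rewrite /winv /= rev_cons -/(winv w) -cats1.
apply: (braid_trans _ (braid_cancel i e)).
rewrite -!cat_cons catA.
apply: (braid_cat (v' := [:: (i, e)]) (w' := [:: (i, ~~ e)]) _ (braid_refl _)).
rewrite -[X in braid_eq _ X]cats0 -cat1s -catA.
exact: braid_cat (braid_refl _) IHw.
Qed.

Lemma winvl w : braid_eq (winv w ++ w) [::].
Proof. by rewrite -{2}[w]winvK; exact: winvr. Qed.

Definition braid_one : braid := \pi_braid [::].
Definition braid_mul (x y : braid) : braid := \pi_braid (repr x ++ repr y).
Definition braid_inv (x : braid) : braid := \pi_braid (winv (repr x)).

Lemma braid_mulA : associative braid_mul.
Proof.
move=> x y z; apply/eqP/braid_piP.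
apply: braid_trans (braid_cat (braid_refl _) (braid_reprK _)) _.
rewrite catA; apply: braid_sym.
exact: braid_cat (braid_reprK _) (braid_refl _).
Qed.

Lemma braid_mul1 : left_id braid_one braid_mul.
Proof.
move=> x; rewrite -[RHS]reprK; apply/eqP/braid_piP.
exact: braid_cat (braid_reprK [::]) (braid_refl (repr x)).
Qed.

Lemma braid_mulr1 : right_id braid_one braid_mul.
Proof.
move=> x; rewrite -[RHS]reprK; apply/eqP/braid_piP.
have := braid_cat (braid_refl (repr x)) (braid_reprK [::]).
by rewrite cats0.
Qed.

Lemma braid_mulVg : left_inverse braid_one braid_inv braid_mul.
Proof.
move=> x; apply/eqP/braid_piP.
apply: (braid_trans _ (winvl (repr x))).
exact: braid_cat (braid_reprK _) (braid_refl _).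
Qed.

Lemma braid_mulgV : right_inverse braid_one braid_inv braid_mul.
Proof.
move=> x; apply/eqP/braid_piP.
apply: (braid_trans _ (winvr (repr x))).
exact: braid_cat (braid_refl _) (braid_reprK _).
Qed.

HB.instance Definition _ := isGroup.Build braid
  braid_mulA braid_mul1 braid_mulr1 braid_mulVg braid_mulgV.

Definition artin (i : 'I_n.-1) : braid := \pi_braid [:: (i, true)].

End BraidGroup.

Definition zexpg (G : groupType) (x : G) (a : int) : G :=
  match a with
  | Posz m => x ^+ m
  | Negz m => x ^- m.+1
  end%g.

(** * Closure of a braid

    The [n] strands of the braid point down; they are closed up by [n] nested
    arcs running on the right of the braid. *)

Definition braid_slices (n : nat) (w : braid_word n) : seq slice :=
  [seq (nat_of_ord c.1, Crossing c.2 true true) | c <- w].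

Definition closure_slices (n : nat) (w : braid_word n) : seq slice :=
  [seq (l, LMax true) | l <- iota 0 n] ++ braid_slices w
    ++ [seq (l, LMin true) | l <- rev (iota 0 n)].

Lemma run_cons w c d : run w (c :: d) = obind (run^~ d) (run_slice w c).
Proof. by []. Qed.

Lemma run_cat w d1 d2 : run w (d1 ++ d2) = obind (run^~ d2) (run w d1).
Proof. by elim: d1 w => //= c d1 IH w; case: (run_slice w c) => //=. Qed.

Definition level (n : nat) := nseq n true ++ nseq n false.

Lemma level_split n : level n.+1 = nseq n true ++ [:: true; false] ++ nseq n false.
Proof. by rewrite /level -addn1 nseqD -catA /= addn1. Qed.

Lemma run_max n : run_slice (level n) (n, LMax true) = Some (level n.+1).
Proof.
rewrite level_split /run_slice /= take0 eqxx andbT addn0.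
by rewrite size_cat size_nseq leq_addr take_size_cat ?drop_size_cat ?size_nseq.
Qed.

Lemma run_min n : run_slice (level n.+1) (n, LMin true) = Some (level n).
Proof.
rewrite level_split /run_slice /= size_cat size_nseq leq_addr /=.
rewrite drop_size_cat ?size_nseq //= take0 eqxx take_size_cat ?size_nseq //.
by rewrite addnC -drop_drop drop_size_cat ?size_nseq //= drop0.
Qed.

Lemma run_maxs n : run [::] [seq (l, LMax true) | l <- iota 0 n] = Some (level n).
Proof.
elim: n => [|n IHn] //.
rewrite -addn1 iotaD map_cat run_cat IHn add0n.
by change (run (level n) [:: (n, LMax true)] = Some (level (n + 1)));
  rewrite run_cons run_max addn1.
Qed.

Lemma run_mins n :
  run (level n) [seq (l, LMin true) | l <- rev (iota 0 n)] = Some [::].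
Proof.
elim: n => [|n IHn] //.
rewrite -addn1 iotaD rev_cat map_cat run_cat add0n addn1.
by rewrite (run_cons _ (n, LMin true) [::]) run_min.
Qed.

Lemma run_braid n (w : braid_word n) :
  run (level n) (braid_slices w) = Some (level n).
Proof.
elim: w => [|[i e] w IHw] //.
suff run_i : run_slice (level n) (i : nat, Crossing e true true) = Some (level n).
  by rewrite [braid_slices _]/= run_cons run_i.
have lt_i : i.+1 < n by rewrite -ltn_predRL.
have -> : level n = nseq i true ++ [:: true; true]
                      ++ (nseq (n - i.+2) true ++ nseq n false).
  by rewrite /level -{1}(subnKC lt_i) -addn2 -addnA !nseqD -!catA.
rewrite /run_slice /= size_cat size_nseq leq_addr /=.
rewrite drop_size_cat ?size_nseq //= take0 eqxx take_size_cat ?size_nseq //.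
by rewrite addnC -drop_drop drop_size_cat ?size_nseq //= drop0.
Qed.

Lemma closure_slicesP n (w : braid_word n) :
  run [::] (closure_slices w) = Some [::].
Proof. by rewrite !run_cat run_maxs /= run_cat run_braid /= run_mins. Qed.

(* The closure of a braid is drawn from a chosen word representing it. *)
Definition braid_closure (n : nat) (beta : braid n) : link_diagram :=
  LinkDiagram (closure_slicesP (repr beta)).

(** * The coefficients [C^a(s)] *)

Definition Ccoef (R : realType) (a : int) : Cs R :=
  ((-1) ^ a * svar R ^ (a - 1) + svar R ^ (1 - a))%R.

(* Main.v *)
(** Cutting open one crossing, the skein relation says that
    [f a = nabla (g x^a h)] satisfies [f (a + 1) = (s^-1 - s) f a + f (a - 1)],
    whose characteristic roots are [s^-1] and [- s].  Solving this recurrence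
    from [f 0] and [f 1] gives the case of one factor, and the formula follows
    by treating the factors one at a time. *)
Require Import Defs.
From HB Require Import structures.
From mathcomp Require Import all_boot all_order all_algebra.
From mathcomp Require Import complex boolp reals.
From mathcomp Require Import ring.

Import GRing.Theory.
Local Open Scope ring_scope.

(** [braid_closure] draws an arbitrary representative; drawing a given word keeps the slices
    explicit, so that local moves and skein triples can be exhibited. *)
Definition word_closure {n : nat} (w : braid_word n) : link_diagram :=
  LinkDiagram (closure_slicesP w).

Local Notation braid_of w := (\pi_(braid _) w)%qT.

Lemma braid_slices_cat n (v w : braid_word n) :
  braid_slices (v ++ w) = braid_slices v ++ braid_slices w.
Proof. exact: map_cat. Qed.

Lemma pi_cat n (v w : braid_word n) :
  (braid_of v * braid_of w)%g = braid_of (v ++ w)%SEQ.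
Proof.
by apply/eqP/braid_piP; apply: braid_cat; apply: braid_reprK.
Qed.

Section WordClosure.
Variables (T : Type) (f : link_diagram -> T) (n : nat).
Hypothesis f_inv : link_invariant f.
Implicit Types u v w t : braid_word n.

Lemma word_closure_local_move u v w t :
  local_move (braid_slices v) (braid_slices w) ->
  f (word_closure (u ++ v ++ t)) = f (word_closure (u ++ w ++ t)).
Proof.
move=> vw; apply: f_inv.
exists ([seq (l, LMax true) | l <- iota 0 n] ++ braid_slices u),
  (braid_slices t ++ [seq (l, LMin true) | l <- rev (iota 0 n)]),
  (braid_slices v), (braid_slices w).
by split=> //=; rewrite /closure_slices !braid_slices_cat -!catA.
Qed.

(** Each braid relation is a local move on the closure: cancellation is [move_R2], far commutation
    [move_exchange], the braid relation [move_R3]. The context [u], [t] varies so that the induction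
    passes through concatenation. *)
Lemma word_closure_eq v w : braid_eq v w -> forall u t,
  f (word_closure (u ++ v ++ t)) = f (word_closure (u ++ w ++ t)).
Proof.
elim=> {v w} [w|v w _ IH|v1 v2 v3 _ IH1 _ IH2|v v' w w' _ IHv _ IHw|i e
  |i j lt_ij|i j ij] u t //.
- by rewrite IH1.
- by rewrite -!catA IHv catA IHw -catA.
- exact/word_closure_local_move/move_R2.
- apply: word_closure_local_move; rewrite /braid_slices /=.
  (* Exactly [j - i.+2] strands separate the two crossings. *)
  have := move_exchange i (j - i.+2) (Crossing true true true)
            (Crossing true true true).
  by rewrite /= addn2 subnKC.
- apply: word_closure_local_move; rewrite /braid_slices /= ij.
  exact: move_R3.
Qed.

Lemma braid_closure_pi w :
  f (braid_closure (braid_of w)) = f (word_closure w).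
Proof.
by have := word_closure_eq _ _ (braid_reprK w) [::] [::]; rewrite /= !cats0.
Qed.

End WordClosure.

Lemma artinV n (i : 'I_n.-1) : ((artin i)^-1)%g = braid_of [:: (i, false)].
Proof.
apply: (mulgI (artin i)); rewrite mulgV pi_cat.
by apply/eqP/braid_piP/braid_sym/braid_cancel.
Qed.

Lemma zexpgS (G : groupType) (x : G) (a : int) :
  zexpg x (a + 1) = (x * zexpg x a)%g.
Proof.
case: a => [m|[|m]].
- by rewrite -PoszD addn1 /= expgS.
- by rewrite /= expg1 mulgV.
- have -> : Negz m.+1 + 1 = Negz m by rewrite !NegzE -addn1 PoszD opprD addrK.
  by rewrite /= [in RHS]expgSr invgM mulgA mulgV mul1g.
Qed.

(** A function on ['I_k.+1] amounts to its value at [ord0] and its restriction to the other indices;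
    this isolates the first factor in the induction on [k]. *)
Lemma sum_ffun_ord_recl (V : nmodType) (T : finType) k
    (F : {ffun 'I_k.+1 -> T} -> V) :
  \sum_j F j = \sum_x \sum_(j : {ffun 'I_k -> T})
     F [ffun l => oapp j x (unlift ord0 l)].
Proof.
rewrite pair_big /=.
rewrite (reindex (fun p : T * {ffun 'I_k -> T} =>
  [ffun l => oapp p.2 p.1 (unlift ord0 l)])) //=.
apply: onW_bij.
exists (fun j : {ffun 'I_k.+1 -> T} => (j ord0, [ffun l => j (lift ord0 l)])).
- case=> x j /=; rewrite ffunE unlift_none; congr pair.
  by apply/ffunP => l; rewrite !ffunE liftK.
- move=> j; apply/ffunP => l; rewrite !ffunE /=.
  by case: unliftP => [l'|] ->; rewrite /= ?ffunE.
Qed.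

Section SkeinRecurrence.
Variables (K : fieldType) (s : K) (f : int -> K).
Hypotheses (s_neq0 : s != 0) (s2D1_neq0 : s ^+ 2 + 1 != 0).
Hypothesis f_rec : forall b, f (b + 2) = (s^-1 - s) * f (b + 1) + f b.

Let C (b : int) := (-1) ^ b * s ^ (b - 1) + s ^ (1 - b).

(** Written as a combination of powers of the roots [- s] and [s^-1], [C] visibly solves the
    recurrence. *)
Lemma skein_coefE b : C b = (- s) ^ b * s^-1 + s^-1 ^ b * s.
Proof.
have s_unit : s \is a GRing.unit by rewrite unitfE.
rewrite /C !exprzDr // expr1z exprN1 -[s ^ (- b)]exprz_inv mulrA.
by rewrite -[- s]mulN1r exprzMl ?unitrN1 // [s * _]mulrC.
Qed.

(** Both sides solve the same second-order recurrence and agree at 0 and 1. The prefactor is the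
    inverse of the difference [s^-1 - (- s)] of the roots. *)
Lemma skein_recurrence b :
  f b = s / (s ^+ 2 + 1) * (C b * f 0 + C (b + 1) * f 1).
Proof.
pose c b := s / (s ^+ 2 + 1) * (C b * f 0 + C (b + 1) * f 1).
have c_rec d : c (d + 2) = (s^-1 - s) * c (d + 1) + c d.
  have s_unit : s \is a GRing.unit by rewrite unitfE.
  rewrite /c !skein_coefE !exprzDr ?unitrV ?unitrN // !expr1z.
  by field; rewrite s_neq0.
have c0 : c 0 = f 0.
  by rewrite /c !skein_coefE add0r !expr0z !expr1z; field; rewrite s_neq0.
have c1 : c 1 = f 1.
  rewrite /c !skein_coefE -[1 + 1 : int]/(Posz 2) -!exprnP.
  by field; rewrite s_neq0.
rewrite -/(c b).
(* Two consecutive values determine the next in either direction. *)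
suff [] : f b = c b /\ f (b + 1) = c (b + 1) by [].
elim: b => [|m [f0 f1]|m [f0 f1]].
- by rewrite add0r c0 c1.
- by rewrite -addn1 PoszD -addrA f_rec c_rec f0 f1.
- have -> : - m.+1%:Z + 1 = - m%:Z by rewrite -addn1 PoszD opprD subrK.
  (* Downwards, the recurrence is solved for its last term, whose coefficient is 1. *)
  split=> //; apply: (addrI ((s^-1 - s) * f (- m%:Z))).
  have := f_rec (- m.+1%:Z); have := c_rec (- m.+1%:Z).
  have -> : - m.+1%:Z + 2 = - m%:Z + 1 by rewrite -addn1 PoszD; ring.
  have -> : - m.+1%:Z + 1 = - m%:Z by rewrite -addn1 PoszD opprD subrK.
  by move=> cE fE; rewrite -fE f1 cE f0.
Qed.

End SkeinRecurrence.

Section Skein.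
Variables (R : realType) (nabla : link_diagram -> Cs R).
Hypothesis nablaP : alexander_conway nabla.
Let s := svar R.

Lemma svar_neq0 : s != 0.
Proof. by rewrite /s /svar tofrac_eq0 polyX_eq0. Qed.

Lemma svar2D1_neq0 : s ^+ 2 + 1 != 0.
Proof.
rewrite /s /svar -tofracXn -tofrac1 -tofracD tofrac_eq0.
by rewrite -size_poly_gt0 size_XnaddC.
Qed.

Variable n : nat.
Implicit Types (i : 'I_n.-1) (g h : braid n).

Let F g := nabla (braid_closure g).

Lemma skein_artin i g h :
  F (g * (artin i * h))%g =
  (s^-1 - s) * F (g * h)%g + F (g * ((artin i)^-1 * h))%g.
Proof.
have word x : exists w, x = braid_of w :> braid n.
  by exists (repr x); rewrite reprK.
have -> : ((artin i)^-1 * h = braid_of [:: (i, false)] * h)%g by rewrite artinV.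
have [u ->] := word g; have [v ->] := word h.
rewrite /artin !pi_cat /F.
rewrite !(braid_closure_pi _ _ _ (conway_invariant nablaP)).
(* An Artin generator closes up to a negative crossing, its inverse to a positive one; as the
   strands are parallel, smoothing deletes the letter. *)
suff /(conway_skein nablaP)/eqP : skein_triple (word_closure (u ++ (i, false) :: v))
    (word_closure (u ++ (i, true) :: v)) (word_closure (u ++ v)).
  by rewrite -addrA -opprD subr_eq0 => /eqP.
exists ([seq (l, LMax true) | l <- iota 0 n] ++ braid_slices u),
  (braid_slices v ++ [seq (l, LMin true) | l <- rev (iota 0 n)]),
  (i : nat), true, true.
by split; rewrite /= /closure_slices !braid_slices_cat -!catA.
Qed.

Lemma skein_zexpg i g h (a : int) :
  F (g * (zexpg (artin i) a * h))%g = s / (s ^+ 2 + 1) *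
    (Ccoef R a * F (g * h)%g + Ccoef R (a + 1) * F (g * (artin i * h))%g).
Proof.
pose f b := F (g * (zexpg (artin i) b * h))%g.
have f_rec b : f (b + 2) = (s^-1 - s) * f (b + 1) + f b.
  have -> : b + 2 = b + 1 + 1 by rewrite -addrA.
  rewrite /f (zexpgS _ _ (b + 1)) -mulgA skein_artin; congr (_ + F (_ * _)%g).
  by rewrite zexpgS !mulgA mulVg mul1g.
have -> : F (g * h)%g = f 0 by rewrite /f /= expg0 mul1g.
have -> : F (g * (artin i * h))%g = f 1 by rewrite /f /= expg1.
exact: skein_recurrence svar_neq0 svar2D1_neq0 f_rec a.
Qed.

(** The prefix [g] absorbs the factors already expanded, so it must vary in the induction. *)
Lemma skein_prod_zexpg k (i : 'I_k -> 'I_n.-1) (a : 'I_k -> int) g :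
  F (g * \prod_(l < k) zexpg (artin (i l)) (a l))%g =
  (s / (s ^+ 2 + 1)) ^+ k *
  \sum_(j : {ffun 'I_k -> 'I_2})
     (\prod_(l < k) Ccoef R (a l + (j l : nat)%:Z)) *
     F (g * \prod_(l < k) (artin (i l) ^+ j l))%g.
Proof.
elim: k => [|k IHk] in i a g *.
  (* There is a single function on ['I_0]; the value [ord0] is a dummy. *)
  rewrite expr0 mul1r (big_pred1 [ffun=> ord0]) ?big_ord0 ?mul1r ?big_ord0 //.
  by move=> j; apply/esym/eqP/ffunP; case.
(* After the first factor is expanded, the induction hypothesis applies with prefix [g] and with [g]
   times the first generator. *)
rewrite big_ord_recl skein_zexpg mulgA !IHk sum_ffun_ord_recl.
rewrite big_ord_recl big_ord1 (exprS _ k) -[RHS]mulrA; congr (_ * _).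
rewrite mulrCA [X in _ + X]mulrCA -mulrDr; congr (_ * _).
rewrite !mulr_sumr; congr (_ + _); apply: eq_bigr => j _;
  rewrite mulrA !big_ord_recl !ffunE unlift_none /=.
- rewrite expg0 mul1g addr0; congr (_ * _ * F (_ * _)%g);
    by apply: eq_bigr => l _; rewrite !ffunE liftK.
- rewrite expg1 mulgA; congr (_ * _ * F (_ * _)%g);
    by apply: eq_bigr => l _; rewrite !ffunE liftK.
Qed.

End Skein.

Theorem theorem1p5 (R : realType) (nabla : link_diagram -> Cs R)
    (nablaP : alexander_conway nabla) (n : nat) (n_ge2 : (2 <= n)%N)
    (k : nat) (i : 'I_k -> 'I_n.-1) (a : 'I_k -> int) :
  nabla (braid_closure (\prod_(l < k) zexpg (artin (i l)) (a l))%g) =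
  (svar R / (svar R ^+ 2 + 1)) ^+ k *
  \sum_(j : {ffun 'I_k -> 'I_2})
     (\prod_(l < k) Ccoef R (a l + (j l : nat)%:Z)) *
     nabla (braid_closure (\prod_(l < k) (artin (i l) ^+ j l))%g).
Proof.
rewrite -[X in braid_closure X]mul1g (skein_prod_zexpg _ _ nablaP).
by congr (_ * _); apply: eq_bigr => j _; rewrite mul1g.
Qed.
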